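(* Let $M\subset\mathbb{C}^2$ be a real-analytic (or formal) hypersurface, $p\in M$, and $(z,w)$ normal coordinates for $M$ at $p$. Then the set $\Lambda_M$ and, for each $(\alpha,n,\mu)\in\Lambda_M$, the tensor $\mathcal{L}^{(\alpha,n,\mu)}$ are independent of the choice of normal coordinates. That is, if $M'\subset\mathbb{C}^2$ is another real-analytic (or formal) hypersurface given in normal coordinates $(z',w')$ at $p'\in M'$ by $w'=Q'(z',\bar z',\bar w')$, and $(z',w')=(F(z,w),G(z,w))$ is a (formal) biholomorphic map sending $M$ into $M'$ with $(F(0),G(0))=(0,0)$, then $\Lambda_M=\Lambda_{M'}$ and for each $(\alpha,n,\mu)\in\Lambda_M$ $$\frac{d^nq_{\alpha,\mu}}{d\chi^n}(0)\,\overline{G_w}(0)=\frac{d^nq'_{\alpha,\mu}}{d\chi^n}(0)\,F_z(0)^\alpha\,\overline{F_z}(0)^n\,\overline{G_w}(0)^\mu .$$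
   Context: $\mathbb{N}=\{0,1,2,\dots\}$. A bar over a power series means that its coefficients are conjugated. Formal hypersurfaces: a formal hypersurface $M$ through $p\in\mathbb{C}^2$ is given by a formal power series $\rho(Z,\bar Z)$ in $Z-p,\overline{Z-p}$ which is real ($\rho_{I\bar J}=\overline{\rho_{J\bar I}}$), has zero constant term, and satisfies $d\rho\ne0$ at $p$. A real-analytic germ is identified with the Taylor series of a defining function. A formal invertible (formal biholomorphic) map $H:(\mathbb{C}^2,p)\to(\mathbb{C}^2,p')$ is a pair of formal power series with invertible Jacobian at $p$. It sends $M$ into $M'$ if $\rho'(H(Z),\overline{H(Z)})=a(Z,\bar Z)\rho(Z,\bar Z)$ for some formal power series $a$. Normal coordinates: these are (formal or local) holomorphic coordinates $(z,w)$ vanishing at $p$ in which $M$ is given by $\operatorname{Im}w=\varphi(z,\bar z,\operatorname{Re}w)$, with $\varphi(z,\chi,s)=\bar\varphi(\chi,z,s)$ and $\varphi(z,0,s)\equiv\varphi(0,\chi,s)\equiv0$. Equivalently, $M$ is given in them by $w=Q(z,\bar z,\bar w)$ with $Q(z,0,\tau)\equiv Q(0,\chi,\tau)\equiv\tau$ and $Q(z,\chi,\bar Q(\chi,z,\tau))\equiv\tau$. Expand $\varphi(z,\chi,s)=\sum_{\alpha\ge1,\mu\ge0}\varphi_{\alpha,\mu}(\chi)z^\alpha s^\mu$ and $Q(z,\chi,\tau)=\tau+\sum_{\alpha\ge1,\mu\ge0}q_{\alpha,\mu}(\chi)z^\alpha\tau^\mu$; the $q'_{\alpha,\mu}$ are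 defined in the same way from $Q'$. Invariant set: on $\mathbb{N}^2$ let $(\alpha,\mu)\preceq(\beta,\nu)$ iff $\alpha+\mu\le\beta+\nu$ and $\mu\le\nu$; let $\prec$ mean $\preceq$ and $\neq$. In given normal coordinates, $(\alpha_0,\mu_0)$ is an invariant pair of $M$ if $\varphi_{\alpha_0,\mu_0}\not\equiv0$ but $\varphi_{\alpha,\mu}\equiv0$ for every $(\alpha,\mu)\prec(\alpha_0,\mu_0)$. $Q_M$ is the set of invariant pairs. For $(\alpha,\mu)\in Q_M$ let $n(\alpha,\mu):=\min\{n:\frac{d^n\varphi_{\alpha,\mu}}{d\chi^n}(0)\neq0\}$, and let $\Lambda_M:=\{(\alpha,n,\mu):(\alpha,\mu)\in Q_M,\ n=n(\alpha,\mu)\}$. Tensors: for $(\alpha,n,\mu)\in\Lambda_M$ the multilinear form $\mathcal{L}^{(\alpha,n,\mu)}$ is defined in the given normal coordinates by $$\mathcal{L}^{(\alpha,n,\mu)}(a_1,\dots,a_\alpha,b_1,\dots,b_n,c_1,\dots,c_\mu):=\frac1{n!}\frac{d^nq_{\alpha,\mu}}{d\chi^n}(0)\,a_1\cdots a_\alpha\,b_1\cdots b_n\,c_1\cdots c_\mu .$$ Here the $a_i,b_j$ are coordinates of vectors in the one-dimensional CR tangent space (spanned by $\partial/\partial\bar z$) and its conjugate, and the $c_l$ and the value are coordinates in the normal space $T^{0,1}_p\mathbb{C}^2/\mathcal V_p$ with respect to $\partial/\partial\bar w$, where $\mathcal V_p=T^{0,1}_p\mathbb{C}^2\cap(\mathbb{C}\otimes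 T_pM)$. Independence of the choice of normal coordinates means precisely the transformation rule displayed in the claim. *)

(* Defs.v *)
From HB Require Import structures.
From mathcomp Require Import all_boot all_order all_algebra.
From mathcomp Require Import mpoly.

Set Implicit Arguments.
Unset Strict Implicit.
Unset Printing Implicit Defensive.

Import Order.TTheory GRing.Theory Num.Theory.
Local Open Scope ring_scope.

(* Formal power series in n variables, given by their coefficients; two series
   are identified when they agree pointwise (=1).  A series centred at a point
   p is stored by its coefficients in Z - p (and conj (Z - p)), so base points
   do not appear: every formal map is written in coordinates centred at its
   source and target, and hence has no constant term. *)
Definition fps (C : numClosedFieldType) (n : nat) := 'X_{1..n} -> C.

Definition fzero {C : numClosedFieldType} {n} : fps C n := fun _ => 0.

Definition fvar {C : numClosedFieldType} {n} (i : 'I_n) : fps C n :=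
  fun m => (m == U_(i)%MM)%:R.

Definition fadd {C : numClosedFieldType} {n} (f g : fps C n) : fps C n :=
  fun m => f m + g m.

Definition fsub {C : numClosedFieldType} {n} (f g : fps C n) : fps C n :=
  fun m => f m - g m.

Definition fscale {C : numClosedFieldType} {n} (c : C) (f : fps C n) : fps C n :=
  fun m => c * f m.

Definition fmul {C : numClosedFieldType} {n} (f g : fps C n) : fps C n :=
  fun m => \sum_(k : 'X_{1..n < (mdeg m).+1, (mdeg m).+1} | m == (k.1 + k.2)%MM)
             f k.1 * g k.2.

Definition fconj {C : numClosedFieldType} {n} (f : fps C n) : fps C n :=
  fun m => (f m)^*.

Definition fderiv {C : numClosedFieldType} {n} (i : 'I_n) (f : fps C n) :
    fps C n :=
  fun m => (m i).+1%:R * f (m + U_(i))%MM.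

(* The value of a series at its centre. *)
Definition fat0 {C : numClosedFieldType} {n} (f : fps C n) : C := f 0%MM.

Definition ftrunc {C : numClosedFieldType} {n} (d : nat) (f : fps C n) :
    {mpoly C[n]} :=
  \sum_(m : 'X_{1..n < d}) f m *: 'X_[m].

(* Substitution f(g_0, ..., g_(n-1)), meaningful when the g_i have no constant
   term: the coefficient at m then only depends on the coefficients of f and
   the g_i of degree at most that of m, so it may be computed on truncations. *)
Definition fcomp {C : numClosedFieldType} {n k : nat} (f : fps C n)
    (g : n.-tuple (fps C k)) : fps C k :=
  fun m => let d := (mdeg m).+1 in
    (ftrunc d f \mPo [tuple ftrunc d (tnth g i) | i < n])@_m.

Definition mnm3 (i j k : nat) : 'X_{1..3} := [multinom [tuple i; j; k]].
Definition mnm4 (i j k l : nat) : 'X_{1..4} := [multinom [tuple i; j; k; l]].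

Definition var3_0 {C : numClosedFieldType} : fps C 3 := fvar (@Ordinal 3 0 isT).
Definition var3_1 {C : numClosedFieldType} : fps C 3 := fvar (@Ordinal 3 1 isT).
Definition var3_2 {C : numClosedFieldType} : fps C 3 := fvar (@Ordinal 3 2 isT).

(* The four variables of a series in (Z, conj Z), Z in C^2, are ordered as
   z, w, conj z, conj w; those of phi (z, chi, s) and Q (z, chi, tau) as
   written. *)
Definition varz {C : numClosedFieldType} : fps C 4 := fvar (@Ordinal 4 0 isT).
Definition varw {C : numClosedFieldType} : fps C 4 := fvar (@Ordinal 4 1 isT).
Definition varzb {C : numClosedFieldType} : fps C 4 := fvar (@Ordinal 4 2 isT).
Definition varwb {C : numClosedFieldType} : fps C 4 := fvar (@Ordinal 4 3 isT).

Definition formal_hypersurface {C : numClosedFieldType} (rho : fps C 4) : Prop :=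
  [/\ forall i j k l, rho (mnm4 i j k l) = (rho (mnm4 k l i j))^*,
      fat0 rho = 0
    & exists i : 'I_4, fat0 (fderiv i rho) != 0].

Definition jacobian0 {C : numClosedFieldType} (H : 2.-tuple (fps C 2)) : 'M[C]_2 :=
  \matrix_(i, j) fat0 (fderiv j (tnth H i)).

Definition formal_biholomorphism {C : numClosedFieldType}
    (H : 2.-tuple (fps C 2)) : Prop :=
  (forall i, fat0 (tnth H i) = 0) /\ jacobian0 H \in unitmx.

(* rho (H(Z), conj (H(Z))) *)
Definition pullback {C : numClosedFieldType} (H : 2.-tuple (fps C 2))
    (rho : fps C 4) : fps C 4 :=
  let hol f := fcomp f [tuple varz; varw] in
  let antihol f := fcomp (fconj f) [tuple varzb; varwb] in
  fcomp rho [tuple hol [tnth H 0]; hol [tnth H 1];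
                   antihol [tnth H 0]; antihol [tnth H 1]].

Definition sends_into {C : numClosedFieldType} (H : 2.-tuple (fps C 2))
    (rho rho' : fps C 4) : Prop :=
  exists a : fps C 4, pullback H rho' =1 fmul a rho.

(* The equations rho = 0 and r = 0 define the same formal hypersurface; r may
   be complex valued. *)
Definition given_by {C : numClosedFieldType} (rho r : fps C 4) : Prop :=
  exists a : fps C 4, fat0 a != 0 /\ rho =1 fmul a r.

(* Im w - phi (z, conj z, Re w) *)
Definition eq_phi {C : numClosedFieldType} (phi : fps C 3) : fps C 4 :=
  fsub (fscale (2%:R * 'i)^-1 (fsub varw varwb))
       (fcomp phi [tuple varz; varzb; fscale 2%:R^-1 (fadd varw varwb)]).

(* w - Q (z, conj z, conj w) *)
Definition eq_Q {C : numClosedFieldType} (Q : fps C 3) : fps C 4 :=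
  fsub varw (fcomp Q [tuple varz; varzb; varwb]).

Definition normal_phi {C : numClosedFieldType} (phi : fps C 3) : Prop :=
  [/\ phi =1 fcomp (fconj phi) [tuple var3_1; var3_0; var3_2],
      fcomp phi [tuple var3_0; fzero; var3_2] =1 fzero
    & fcomp phi [tuple fzero; var3_1; var3_2] =1 fzero].

Definition normal_Q {C : numClosedFieldType} (Q : fps C 3) : Prop :=
  [/\ fcomp Q [tuple var3_0; fzero; var3_2] =1 var3_2,
      fcomp Q [tuple fzero; var3_1; var3_2] =1 var3_2
    & fcomp Q [tuple var3_0; var3_1;
                 fcomp (fconj Q) [tuple var3_1; var3_0; var3_2]] =1 var3_2].

(* Coordinates (z, w) are given by the formal biholomorphism P expressing the
   original coordinates as Z = P (z, w); pullback P rho is then a defining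
   series of M in the coordinates (z, w). *)
Definition normal_coordinates {C : numClosedFieldType} (rho : fps C 4)
    (P : 2.-tuple (fps C 2)) (phi Q : fps C 3) : Prop :=
  [/\ formal_biholomorphism P,
      normal_phi phi, given_by (pullback P rho) (eq_phi phi),
      normal_Q Q & given_by (pullback P rho) (eq_Q Q)].

(* The one-variable series phi_(alpha,mu) (chi), resp. q_(alpha,mu) (chi) for
   alpha >= 1.  For alpha = 0 the former vanishes in normal coordinates, so no
   pair (0, mu) is invariant. *)
Definition zs_coef {C : numClosedFieldType} (f : fps C 3) (alpha mu : nat) :
    fps C 1 :=
  fun m => f (mnm3 alpha (m ord0) mu).

(* (d^n f / d chi^n) (0) *)
Definition dn0 {C : numClosedFieldType} (n : nat) (f : fps C 1) : C :=
  fat0 (iter n (fderiv ord0) f).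

Definition pair_le (x y : nat * nat) : bool :=
  (x.1 + x.2 <= y.1 + y.2)%N && (x.2 <= y.2)%N.

Definition pair_lt (x y : nat * nat) : bool := pair_le x y && (x != y).

Definition invariant_pair {C : numClosedFieldType} (phi : fps C 3)
    (x : nat * nat) : Prop :=
  ~ (zs_coef phi x.1 x.2 =1 fzero) /\
  forall y : nat * nat, pair_lt y x -> zs_coef phi y.1 y.2 =1 fzero.

Definition in_Lambda {C : numClosedFieldType} (phi : fps C 3)
    (alpha n mu : nat) : Prop :=
  [/\ invariant_pair phi (alpha, mu),
      dn0 n (zs_coef phi alpha mu) != 0
    & forall k, (k < n)%N -> dn0 k (zs_coef phi alpha mu) = 0].

Definition tensorL {C : numClosedFieldType} (Q : fps C 3) (alpha n mu : nat)
    (a : 'I_alpha -> C) (b : 'I_n -> C) (c : 'I_mu -> C) : C :=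
  (n`!)%:R^-1 * dn0 n (zs_coef Q alpha mu) *
  (\prod_i a i) * (\prod_i b i) * (\prod_i c i).

(* Main.v *)
Require Import Defs.
From HB Require Import structures.
From mathcomp Require Import all_boot all_order all_algebra.
From mathcomp Require Import reals complex mpoly.
From mathcomp Require boolp.
From mathcomp Require Import zify ring.

Set Implicit Arguments.
Unset Strict Implicit.
Unset Printing Implicit Defensive.

Import Order.TTheory GRing.Theory Num.Theory.
Local Open Scope ring_scope.

(** A monomial z^a chi^c tau^b carries the pair (a, b), and the data of the
    theorem are the lowest monomials of phi for a suitable partial order.  Put
    k <= m when the pair of k precedes the pair of m in the order of the
    invariant set and, if both pairs are equal, the chi-exponent of k is at
    most that of m ([weight_le]).  This order is compatible with products and
    well founded, and (alpha, n, mu) belongs to Lambda_M exactly when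
    z^alpha chi^n tau^mu is a minimal monomial of phi
    ([in_Lambda_leading]).  So it has to be shown that phi, q = Q - tau and
    q' = Q' - tau share their minimal monomials, and that the coefficients of
    q and q' there obey the transformation rule.

    Substituting w = Q(z, chi, tau) into the defining series annihilates
    w - Q, and a factor with nonzero constant term can be cancelled.  This
    turns the hypotheses into two identities of series in (z, chi, tau):
      (Q - tau) / (2 i) = phi(z, chi, (Q + tau) / 2)        ([Q_phi_eq]),
      G(z, Q) = conj G(chi, tau) + q'(F(z, Q), conj F(chi, tau), conj G(chi, tau))
                                                 ([map_equation], [map_eqE]).

    Both are read at a monomial m below which q, respectively q and q', has no
    terms.  On the one hand h(z, chi, tau + q) and h + h_tau(0) q have the same
    coefficient at m ([fcomp_perturb]): every other term is q times a series
    without constant term.  As phi_tau(0) = 0, the first identity gives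
    q_m = 2 i phi_m.  On the other hand F(z, Q), conj F(chi, tau) and
    conj G(chi, tau) have z, chi and tau as their lowest monomials, with
    coefficients F_z(0), conj F_z(0) and conj G_w(0) ([map_on_Q_weight]);
    because the order is multiplicative, the composition with q' has the
    coefficient q'_m F_z(0)^a (conj F_z(0))^c (conj G_w(0))^b at m
    ([fcomp_weight_lead]).  The series G(z, tau) and conj G(chi, tau) do not
    involve monomials containing both z and chi, so the second identity becomes
    G_w(0) q_m = q'_m F_z(0)^a (conj F_z(0))^c (conj G_w(0))^b
    ([lead_transform]).  Since G_w(0) is real ([Gw_real]) and G(z, 0) = 0
    ([G_z_axis]) makes F_z(0) and G_w(0) nonzero, the minimal monomials
    agree by well-founded induction ([leading_transfer]). *)

(** * Coefficients of composed polynomials *)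

Lemma mnm_ind n (P : 'X_{1..n} -> Prop) :
  P 0%MM -> (forall i e, P e -> P (U_(i) + e)%MM) -> forall e, P e.
Proof.
move=> P0 PS e; move: {2}(mdeg e) (erefl (mdeg e)) => d.
elim: d e => [|d IH] e de; first by move/eqP: de; rewrite mdeg_eq0 => /eqP->.
have [i ei] : exists i, (e i > 0)%N.
  apply/existsP; rewrite -[X in is_true X]negbK; apply/negP => /existsPn e0.
  have : mdeg e = 0%N.
    by rewrite mdegE big1 // => i _; apply/eqP; rewrite -leqn0 leqNgt.
  by rewrite de.
have le_ie : (U_(i) <= e)%MM by rewrite lep1mP -lt0n.
rewrite -(submK le_ie) addmC; apply/PS/IH.
by move: de; rewrite -{1}(submK le_ie) mdegD mdeg1 addn1 => -[].
Qed.

(** The product has a single contribution at a + b when a is the only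
    possible first factor. *)
Lemma mcoeffM_lead (C : comNzRingType) n (p q : {mpoly C[n]}) a b :
    (forall x y, p@_x != 0 -> q@_y != 0 -> (x + y = a + b)%MM -> x = a) ->
  (p * q)@_(a + b) = p@_a * q@_b.
Proof.
move=> H; rewrite mcoeffM; set d := (mdeg (a + b)).+1.
have da : (mdeg a < d)%N by rewrite ltnS mdegD leq_addr.
have db : (mdeg b < d)%N by rewrite ltnS mdegD leq_addl.
rewrite (bigD1 (BMultinom da, BMultinom db)) //= big1 ?addr0 //.
move=> -[[x dx] [y dy]] /= /andP[/eqP abxy]; rewrite xpair_eqE !bmeqP /=.
have [->|px] := eqVneq p@_x 0; first by rewrite mul0r.
have [->|qy] := eqVneq q@_y 0; first by rewrite mulr0.
have xa := H x y px qy (esym abxy).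
by move: abxy; rewrite xa => /addmI <-; rewrite !eqxx.
Qed.

Lemma mcoeff_comp (C : comNzRingType) n k (p : {mpoly C[n]})
    (r : n.-tuple {mpoly C[k]}) m :
  (p \mPo r)@_m = \sum_(e <- msupp p) p@_e * ('X_[e] \mPo r)@_m.
Proof.
rewrite comp_mpolyEX (raddf_sum (mcoeff m)) /=.
by apply: eq_bigr => e _; rewrite mcoeffZ.
Qed.

(** [P e m] is an a priori bound on the monomials m that can occur when X^e is
    evaluated at r.  It is enough to check it on the variables, because it is
    additive.  If moreover T (U_i + e) splits only as T U_i + T e within these
    bounds, the coefficient there is the product of the corresponding
    coefficients of r. *)
Section MonomialSubstitution.
Variables (C : comNzRingType) (n k : nat) (r : n.-tuple {mpoly C[k]}).
Variable P : 'X_{1..n} -> 'X_{1..k} -> Prop.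
Hypothesis P0 : P 0%MM 0%MM.
Hypothesis PD : forall i e m m', P U_(i)%MM m -> P e m' ->
  P (U_(i) + e)%MM (m + m')%MM.
Hypothesis PU : forall i m, (tnth r i)@_m != 0 -> P U_(i)%MM m.

Lemma comp_monomial_supp e m : ('X_[e] \mPo r)@_m != 0 -> P e m.
Proof.
elim/mnm_ind: e m => [|i e IH] m.
  rewrite mpolyX0 comp_mpoly1 mcoeff1.
  by case: (m =P 0%MM) => [->|_]; rewrite ?eqxx.
rewrite mpolyXD rmorphM /= comp_mpolyXU -tnth_nth mcoeffM.
have [Pm _ //|nPm] := boolp.pselect (P (U_(i) + e)%MM m).
rewrite big1 ?eqxx // => -[[x dx] [y dy]] /= /eqP mE.
have [->|px] := eqVneq ((tnth r i)@_x) 0; first by rewrite mul0r.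
have [->|qy] := eqVneq (('X_[e] \mPo r)@_y) 0; first by rewrite mulr0.
by case: nPm; rewrite mE; apply: PD; [apply: PU|apply: IH].
Qed.

Variable T : 'X_{1..n} -> 'X_{1..k}.
Hypothesis T0 : T 0%MM = 0%MM.
Hypothesis TD : forall i e, T (U_(i) + e)%MM = (T U_(i) + T e)%MM.
Hypothesis PT : forall i e m m', P U_(i)%MM m -> P e m' ->
  (m + m' = T U_(i) + T e)%MM -> m = T U_(i)%MM.

Lemma comp_monomial_lead e :
  ('X_[e] \mPo r)@_(T e) = \prod_i (tnth r i)@_(T U_(i)%MM) ^+ e i.
Proof.
elim/mnm_ind: e => [|i e IH].
  rewrite mpolyX0 comp_mpoly1 mcoeff1 T0 eqxx big1 // => i _.
  by rewrite mnm0E expr0.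
rewrite mpolyXD rmorphM /= comp_mpolyXU -tnth_nth TD mcoeffM_lead.
  rewrite IH (bigD1 i) //= [RHS](bigD1 i) //= mulrA mnmDE mnm1E eqxx exprS.
  congr (_ * _); apply: eq_bigr => j /negPf ji.
  by rewrite mnmDE mnm1E eq_sym ji.
by move=> x y rx ey; apply: PT; [apply: PU|apply: comp_monomial_supp].
Qed.

End MonomialSubstitution.

(** * Composition of formal power series *)

Section Truncation.
Variable C : numClosedFieldType.

Lemma ftruncE n d (f : fps C n) m : (mdeg m < d)%N -> (ftrunc d f)@_m = f m.
Proof. exact: mcoeff_mpoly. Qed.

Lemma ftrunc_out n d (f : fps C n) m : (d <= mdeg m)%N -> (ftrunc d f)@_m = 0.
Proof.
move=> dm; rewrite /ftrunc raddf_sum big1 //= => -[i /= di] _.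
rewrite mcoeffZ mcoeffX; case: eqP => [im|_]; last by rewrite mulr0.
by move: dm; rewrite leqNgt -im di.
Qed.

Lemma ftrunc_neq0 n d (f : fps C n) m : (ftrunc d f)@_m != 0 -> f m != 0.
Proof.
have [md|/(@ftrunc_out _ _ f)->] := ltnP (mdeg m) d; first by rewrite ftruncE.
by rewrite eqxx.
Qed.

(** A record rather than a definition, so that unification does not unfold it
    to an equation between coefficients. *)
Record approx n d (p : {mpoly C[n]}) (f : fps C n) : Prop := Approx {
  approxE : forall m, (mdeg m < d)%N -> p@_m = f m }.

Lemma approx_ftrunc n d (f : fps C n) : approx d (ftrunc d f) f.
Proof. by split=> m; apply: ftruncE. Qed.

Lemma approx_mul n d (p q : {mpoly C[n]}) f g :
  approx d p f -> approx d q g -> approx d (p * q) (fmul f g).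
Proof.
case=> pf [qg]; split=> m md; rewrite mcoeffM /fmul; apply: eq_bigr.
move=> -[[x dx] [y dy]] /= /eqP mE; move: md; rewrite mE mdegD => md.
by rewrite pf ?qg //; apply: leq_ltn_trans md; rewrite (leq_addr, leq_addl).
Qed.

Lemma fvar0 k (i : 'I_k) : (fvar i : fps C k) 0%MM = 0.
Proof. by rewrite /fvar eq_sym mnm1_eq0. Qed.

Lemma fvar_neq0 k (i : 'I_k) m : (fvar i : fps C k) m != 0 -> m = U_(i)%MM.
Proof. by rewrite /fvar; case: (m =P U_(i)%MM) => // _; rewrite eqxx. Qed.

Definition no_const n k (g : n.-tuple (fps C k)) :=
  forall i, tnth g i 0%MM = 0.

Lemma no_constP n k (g : n.-tuple (fps C k)) :
  foldr (fun (f : fps C k) P => f 0%MM = 0 /\ P) True g -> no_const g.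
Proof.
case: g => s sn; rewrite /no_const /= => g0 i.
rewrite (tnth_nth fzero) /=; have : (i < size s)%N by rewrite (eqP sn).
elim: s {sn} (nat_of_ord i) g0 => //= f s IH [|j] [f0 g0] //.
exact: IH.
Qed.

Lemma comp_monomial_low n k (r : n.-tuple {mpoly C[k]}) e m :
    (forall i, (tnth r i)@_0 = 0) -> (mdeg m < mdeg e)%N ->
  ('X_[e] \mPo r)@_m = 0.
Proof.
move=> r0; apply: contraTeq; rewrite -leqNgt.
apply: (comp_monomial_supp (P := fun e m => is_true (mdeg e <= mdeg m)%N)).
- by rewrite !mdeg0.
- by move=> i {}e m1 m2 h1 h2; rewrite !mdegD leq_add.
- move=> i {}m ri; rewrite mdeg1 lt0n mdeg_eq0.
  by apply: contraNneq ri => ->; rewrite r0.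
Qed.

(** A substitution without constant terms never lowers the degree, so low
    coefficients of the result depend only on low coefficients of the data. *)
Lemma comp_mpoly_trunc n k d (p p' : {mpoly C[n]}) (r r' : n.-tuple {mpoly C[k]}) :
    (forall i, (tnth r i)@_0 = 0) -> (forall i, (tnth r' i)@_0 = 0) ->
    (forall m, (mdeg m < d)%N -> p@_m = p'@_m) ->
    (forall i m, (mdeg m < d)%N -> (tnth r i)@_m = (tnth r' i)@_m) ->
  forall m, (mdeg m < d)%N -> (p \mPo r)@_m = (p' \mPo r')@_m.
Proof.
move=> r0 r'0 pp' rr' m md; transitivity ((p \mPo r')@_m).
  rewrite 2!mcoeff_comp; apply: eq_bigr => e _.
  suff -> : ('X_[e] \mPo r)@_m = ('X_[e] \mPo r')@_m by [].
  elim/mnm_ind: e m md => [|i e IH] m md; first by rewrite mpolyX0 2!comp_mpoly1.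
  rewrite mpolyXD 2!(rmorphM (comp_mpoly _)) /= 2!comp_mpolyXU -2!tnth_nth.
  pose f x := (tnth r' i)@_x; pose g x := ('X_[e] \mPo r')@_x.
  have Hr : approx d (tnth r i) f by split=> x; apply: rr'.
  have Hr' : approx d (tnth r' i) f by split.
  have Hg : approx d ('X_[e] \mPo r) g by split=> x; apply: IH.
  have Hg' : approx d ('X_[e] \mPo r') g by split.
  exact: etrans (approxE (approx_mul Hr Hg) md)
                (esym (approxE (approx_mul Hr' Hg') md)).
apply/eqP; rewrite -subr_eq0 -mcoeffB -comp_mpolyB mcoeff_comp.
rewrite big1 // => e _.
have [ed|de] := ltnP (mdeg e) d; first by rewrite mcoeffB pp' // subrr mul0r.
by rewrite comp_monomial_low ?mulr0 //; apply: leq_trans de.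
Qed.

Lemma tnth_ftrunc n k d (g : n.-tuple (fps C k)) i :
  tnth [tuple ftrunc d (tnth g i) | i < n] i = ftrunc d (tnth g i).
Proof. by rewrite tnth_mktuple. Qed.

(** The coefficient of a composed series may be computed on any polynomials
    that approximate the data well enough, not only on the truncations at the
    degree at hand; the algebraic laws of composition follow from those of
    polynomials. *)
Lemma approx_comp n k d (p : {mpoly C[n]}) (r : n.-tuple {mpoly C[k]}) f g :
    no_const g -> approx d p f -> (forall i, approx d (tnth r i) (tnth g i)) ->
  approx d (p \mPo r) (fcomp f g).
Proof.
move=> g0 [pf] rg; split=> m md; rewrite /fcomp.
have d_gt0 : (0 < d)%N by apply: leq_ltn_trans md.
apply: (@comp_mpoly_trunc _ _ (mdeg m).+1) => //.
- by move=> i; rewrite (approxE (rg i)) ?mdeg0.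
- by move=> i; rewrite tnth_ftrunc ftruncE ?mdeg0.
- by move=> e em; rewrite ftruncE // pf //; apply: leq_trans md.
- by move=> i e em; rewrite tnth_ftrunc ftruncE // (approxE (rg i)) //; apply: leq_trans md.
Qed.

Lemma fcompE n k d (f : fps C n) (g : n.-tuple (fps C k)) m :
    no_const g -> (mdeg m < d)%N ->
  fcomp f g m =
    \sum_(e : 'X_{1..n < d})
       f e * ('X_[e] \mPo [tuple ftrunc d (tnth g i) | i < n])@_m.
Proof.
move=> g0 md; set r := [tuple _ | i < n].
rewrite -(approxE (approx_comp (d := d) (p := ftrunc d f) (r := r) _ _ _)) //.
- rewrite {1}/ftrunc (raddf_sum (comp_mpoly r)) (raddf_sum (mcoeff m)) /=.
  by apply: eq_bigr => e _; rewrite comp_mpolyZ mcoeffZ.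
- exact: approx_ftrunc.
- by move=> i; rewrite tnth_ftrunc; apply: approx_ftrunc.
Qed.

Lemma fcomp_at0 n k (f : fps C n) (g : n.-tuple (fps C k)) :
  no_const g -> fcomp f g 0%MM = f 0%MM.
Proof.
move=> g0; rewrite (fcompE (d := 1)) ?mdeg0 // (bigD1 bm0) //= big1.
  by rewrite mpolyX0 comp_mpoly1 mcoeff1 eqxx mulr1 addr0.
move=> [e /= de]; rewrite bmeqP /= -mdeg_eq0.
by move: de; rewrite ltnS leqn0 => ->.
Qed.

Section FixInner.
Variables (n k : nat) (g : n.-tuple (fps C k)).
Hypothesis g0 : no_const g.

Lemma fcomp_add f1 f2 : fcomp (fadd f1 f2) g = fadd (fcomp f1 g) (fcomp f2 g).
Proof.
apply: boolp.funext => m; rewrite /fadd !(fcompE (d := (mdeg m).+1)) //.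
by rewrite -big_split; apply: eq_bigr => e _; rewrite mulrDl.
Qed.

Lemma fcomp_sub f1 f2 : fcomp (fsub f1 f2) g = fsub (fcomp f1 g) (fcomp f2 g).
Proof.
apply: boolp.funext => m; rewrite /fsub !(fcompE (d := (mdeg m).+1)) //.
by rewrite -sumrB; apply: eq_bigr => e _; rewrite mulrBl.
Qed.

Lemma fcomp_scale c f : fcomp (fscale c f) g = fscale c (fcomp f g).
Proof.
apply: boolp.funext => m; rewrite /fscale !(fcompE (d := (mdeg m).+1)) //.
by rewrite mulr_sumr; apply: eq_bigr => e _; rewrite mulrA.
Qed.

Lemma fcomp_mul f1 f2 : fcomp (fmul f1 f2) g = fmul (fcomp f1 g) (fcomp f2 g).
Proof.
apply: boolp.funext => m; set d := (mdeg m).+1.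
pose r := [tuple ftrunc d (tnth g i) | i < n].
have rg i : approx d (tnth r i) (tnth g i).
  by rewrite tnth_ftrunc; apply: approx_ftrunc.
have Hp f : approx d (ftrunc d f \mPo r) (fcomp f g).
  by apply: approx_comp => //; apply: approx_ftrunc.
have H12 : approx d ((ftrunc d f1 * ftrunc d f2) \mPo r) (fcomp (fmul f1 f2) g).
  by apply: approx_comp => //; apply: approx_mul; apply: approx_ftrunc.
rewrite -(approxE H12) // (rmorphM (comp_mpoly r)).
by rewrite (approxE (approx_mul (Hp f1) (Hp f2))).
Qed.

Lemma fcomp_var i : fcomp (fvar i) g = tnth g i.
Proof.
apply: boolp.funext => m; set d := (mdeg m).+2.
rewrite (fcompE (d := d)) //.
have di : (mdeg (U_(i) : 'X_{1..n}) < d)%N by rewrite mdeg1.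
rewrite (bigD1 (BMultinom di)) //= big1.
  by rewrite /fvar eqxx mul1r addr0 comp_mpolyXU -tnth_nth tnth_ftrunc ftruncE.
by move=> e; rewrite bmeqP /= /fvar => /negPf->; rewrite mul0r.
Qed.

Lemma fcomp_comp n' (f : fps C n') (h : n'.-tuple (fps C n)) : no_const h ->
  fcomp (fcomp f h) g = fcomp f (map_tuple (fcomp^~ g) h).
Proof.
move=> h0; apply: boolp.funext => m; set d := (mdeg m).+1.
pose r := [tuple ftrunc d (tnth g i) | i < n].
pose s := [tuple ftrunc d (tnth h i) | i < n'].
have rg i : approx d (tnth r i) (tnth g i).
  by rewrite tnth_ftrunc; apply: approx_ftrunc.
have sh i : approx d (tnth s i) (tnth h i).
  by rewrite tnth_ftrunc; apply: approx_ftrunc.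
have fr : approx d (ftrunc d f) f by apply: approx_ftrunc.
rewrite -(approxE (approx_comp g0 (approx_comp h0 fr sh) rg)) //.
have -> : ftrunc d f \mPo s \mPo r =
          ftrunc d f \mPo map_tuple (fun p => p \mPo r) s.
  rewrite [ftrunc d f \mPo s]comp_mpolyEX [RHS]comp_mpolyEX raddf_sum /=.
  apply: eq_bigr => e _; rewrite comp_mpolyZ; congr (_ *: _).
  rewrite !comp_mpolyX (rmorph_prod (comp_mpoly r)); apply: eq_bigr => i _ /=.
  by rewrite [in RHS]tnth_map (rmorphXn (comp_mpoly r)).
apply: (approxE (d := d)) => //; apply: approx_comp => // i.
  by rewrite tnth_map fcomp_at0.
rewrite (tnth_map (fcomp^~ g)) (tnth_map (fun p => p \mPo r)).
exact: (approx_comp g0 (sh i) rg).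
Qed.

End FixInner.
End Truncation.

(** * Coefficients of a composed series *)

Section Substitution.
Variable C : numClosedFieldType.

(** Lowest degree first: at m, all other products involve coefficients of f
    of smaller degree. *)
Lemma fmul_unit_eq0 n (u f : fps C n) :
  fat0 u != 0 -> fmul u f = fzero -> f = fzero.
Proof.
move=> u0 uf0; apply: boolp.funext => m.
have [d] := ubnP (mdeg m); elim: d m => [//|d IH] m md.
have /eqP : fmul u f m = 0 by rewrite uf0.
have dm : (mdeg m < (mdeg m).+1)%N by [].
have d0 : (mdeg (0 : 'X_{1..n})%MM < (mdeg m).+1)%N by rewrite mdeg0.
rewrite /fmul (bigD1 (BMultinom d0, BMultinom dm)) /= ?add0m // big1 ?addr0.
  by rewrite mulf_eq0 (negPf u0) => /eqP.
move=> -[[x dx] [y dy]] /= /andP[/eqP mE]; rewrite xpair_eqE !bmeqP /= => xy.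
have x0 : (0 < mdeg x)%N.
  rewrite lt0n mdeg_eq0; apply: contraNneq xy => x0.
  by rewrite mE x0 add0m !eqxx.
by rewrite IH ?mulr0 // -ltnS; move: md; rewrite mE mdegD; lia.
Qed.

Section Graded.
Variables (n k : nat) (g : n.-tuple (fps C k)).
Variable P : 'X_{1..n} -> 'X_{1..k} -> Prop.
Hypothesis g0 : no_const g.
Hypothesis P0 : P 0%MM 0%MM.
Hypothesis PD : forall i e m m', P U_(i)%MM m -> P e m' ->
  P (U_(i) + e)%MM (m + m')%MM.
Hypothesis PU : forall i m, tnth g i m != 0 -> P U_(i)%MM m.

Lemma ftrunc_supp d i m :
  (tnth [tuple ftrunc d (tnth g i) | i < n] i)@_m != 0 -> P U_(i)%MM m.
Proof. by rewrite tnth_ftrunc => /ftrunc_neq0; apply: PU. Qed.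

Lemma fcomp_supp f m : fcomp f g m != 0 -> exists2 e, f e != 0 & P e m.
Proof.
move=> nz; apply: boolp.contrapT => nex; case/negP: nz; apply/eqP.
rewrite (fcompE (d := (mdeg m).+1)) // big1 // => e _.
have [->|fe] := eqVneq (f e) 0; first by rewrite mul0r.
apply/eqP; rewrite mulf_eq0; apply/orP; right; apply/eqP.
apply: boolp.contrapT => /eqP nz; apply: nex; exists e => //.
by apply: comp_monomial_supp nz => //; apply: ftrunc_supp.
Qed.

Variable T : 'X_{1..n} -> 'X_{1..k}.
Hypothesis T0 : T 0%MM = 0%MM.
Hypothesis TD : forall i e, T (U_(i) + e)%MM = (T U_(i) + T e)%MM.
Hypothesis PT : forall i e m m', P U_(i)%MM m -> P e m' ->
  (m + m' = T U_(i) + T e)%MM -> m = T U_(i)%MM.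

(** At T m only the monomial m of f contributes, by the bound P. *)
Lemma fcomp_lead f m :
    (forall e, P e (T m) -> e != m -> f e = 0) ->
  fcomp f g (T m) = f m * \prod_i (tnth g i (T U_(i)%MM)) ^+ m i.
Proof.
move=> fm; pose d := (mdeg (T m) + mdeg m + \sum_i mdeg (T U_(i)%MM)).+1.
have dTm : (mdeg (T m) < d)%N by rewrite ltnS -addnA leq_addr.
have dm : (mdeg m < d)%N by rewrite ltnS addnAC leq_addl.
have dU i : (mdeg (T U_(i)%MM) < d)%N.
  rewrite ltnS (bigD1 i) //=; lia.
rewrite (fcompE (d := d)) // (bigD1 (BMultinom dm)) //= big1 ?addr0.
  rewrite (comp_monomial_lead P0 PD (@ftrunc_supp d) T0 TD PT).
  by congr (_ * _); apply: eq_bigr => i _; rewrite tnth_ftrunc ftruncE.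
move=> e; rewrite bmeqP /= => em.
have [nz|] := eqVneq (('X_[e] \mPo [tuple ftrunc d (tnth g i) | i < n])@_(T m)) 0.
  by rewrite nz mulr0.
move/(comp_monomial_supp P0 PD (@ftrunc_supp d)) => /fm-> //.
by rewrite mul0r.
Qed.

End Graded.

Lemma fcomp_diag n (f : fps C n) (g : n.-tuple (fps C n)) m :
    (forall i k, tnth g i k != 0 -> k = U_(i)%MM) ->
  fcomp f g m = f m * \prod_i (tnth g i U_(i)%MM) ^+ m i.
Proof.
move=> gU; apply: (@fcomp_lead n n g (fun e k => k = e) _ _ _ _ id) => //.
- by move=> i; apply/eqP; apply: contraFT (mnm1_eq0 i) => /gU <-.
- by move=> i e k k' -> ->.
- by move=> e ->; rewrite eqxx.
Qed.

Lemma fcomp_id n (f : fps C n) : fcomp f [tuple fvar i | i < n] = f.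
Proof.
apply: boolp.funext => m; rewrite fcomp_diag.
  rewrite big1 ?mulr1 // => i _.
  by rewrite tnth_mktuple /fvar eqxx expr1n.
move=> i k; rewrite tnth_mktuple /fvar.
by case: (k =P U_(i)%MM) => // _; rewrite eqxx.
Qed.

(** Replacing X_i by X_i + u changes X^e by u times a polynomial S whose
    constant term is 1 for e = U_i and 0 otherwise; as u has no terms at the
    proper divisors of m, the product u S contributes u_m S_0 at m. *)
Lemma mcoeff_perturb_monomial k (i : 'I_k) (u : {mpoly C[k]}) (e m : 'X_{1..k}) :
    u@_0 = 0 -> (forall j, (j <= m)%MM -> j != m -> u@_j = 0) ->
  ('X_[e] \mPo [tuple 'X_j + (j == i)%:R * u | j < k])@_m =
    (e == m)%:R + (e == U_(i)%MM)%:R * u@_m.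
Proof.
move=> u0 um; set r := [tuple _ | j < k].
(* The part of e that does not involve X_i. *)
pose e' := (e - U_(i) *+ e i)%MM.
have e'i : e' i = 0%N by rewrite mnmBE mulmnE mnm1E eqxx mul1n subnn.
have eE : e = (e' + U_(i) *+ e i)%MM.
  apply/mnmP => j; rewrite mnmDE mnmBE mulmnE mnm1E.
  by case: (i =P j) => [->|_]; lia.
have He' : 'X_[e'] \mPo r = 'X_[e'].
  rewrite comp_mpolyX [RHS]mpolyXE_id; apply: eq_bigr => j _.
  rewrite tnth_mktuple; have [->|_] := eqVneq j i; first by rewrite e'i !expr0.
  by rewrite mul0r addr0.
have He : 'X_[e] \mPo r = 'X_[e'] * ('X_i + u) ^+ e i.
  rewrite {1}eE mpolyXD -mpolyXn (rmorphM (comp_mpoly r)) /= He'; congr (_ * _).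
  rewrite (rmorphXn (comp_mpoly r)) /= comp_mpolyXU -tnth_nth tnth_mktuple.
  by rewrite eqxx mul1r.
pose S := 'X_[e'] * \sum_(l < e i) ('X_i + u) ^+ ((e i).-1 - l) * 'X_i ^+ l.
have {He} -> : 'X_[e] \mPo r = 'X_[e] + u * S.
  have HX : 'X_[e] = 'X_[e'] * 'X_i ^+ e i :> {mpoly C[k]}.
    by rewrite {1}eE mpolyXD -mpolyXn.
  rewrite He HX /S mulrCA -mulrDr; congr (_ * _); apply/eqP.
  by rewrite [eqbRHS]addrC -subr_eq subrXX [X in X - _]addrC addrK.
have S0 : S@_0 = (e == U_(i)%MM)%:R.
  rewrite (rmorphM (mcoeff 0)) /= mcoeffX (raddf_sum (mcoeff 0)) /=.
  have -> : \sum_(l < e i) (('X_i + u) ^+ ((e i).-1 - l) * 'X_i ^+ l)@_0 =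
            (e i == 1%N)%:R :> C.
    under eq_bigr => l _.
      rewrite (rmorphM (mcoeff 0)) /= !(rmorphXn (mcoeff 0)) /= mcoeffD u0.
      rewrite mcoeffX mnm1_eq0 addr0 !expr0n -natrM mulnb. over.
    rewrite -natr_sum; case: (e i) => [|[|c]]; rewrite ?big_ord0 ?big_ord1 //.
    by rewrite big1 // => -[l /= lc] _; apply/eqP; rewrite eqb0; lia.
  rewrite -natrM mulnb; congr (nat_of_bool _)%:R.
  apply/andP/eqP => [[/eqP e'0 /eqP ei]|eU].
    by rewrite eE e'0 ei add0m mulm1n.
  have ei : e i = 1%N by rewrite eU mnm1E eqxx.
  by rewrite ei /e' ei eU mulm1n; split=> //; apply/eqP/mnmP => j;
     rewrite mnmBE subnn mnm0E.
rewrite mcoeffD mcoeffX; congr (_ + _).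
rewrite -[in LHS](addm0 m) mcoeffM_lead ?S0 1?mulrC // => x y ux _.
rewrite addm0 => xym; apply/eqP; apply: contraNT ux => xm; rewrite um //.
by rewrite -xym lem_addr.
Qed.

Lemma ftrunc_fvar k d (j : 'I_k) : (1 < d)%N -> ftrunc d (fvar j : fps C k) = 'X_j.
Proof.
move=> d1; apply/mpolyP => m; rewrite mcoeffX.
have [md|md] := ltnP (mdeg m) d; first by rewrite ftruncE // /fvar eq_sym.
rewrite ftrunc_out //; case: eqP => // jm; move: md.
by rewrite -jm mdeg1 leqNgt d1.
Qed.

(** First-order Taylor expansion in one variable.  It is exact at m since u,
    the difference between the substituted series and the variable i, vanishes
    at all proper divisors of m. *)
Lemma fcomp_perturb k (i : 'I_k) (h : fps C k) (g : k.-tuple (fps C k)) m :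
    tnth g i 0%MM = 0 -> (forall j, j != i -> tnth g j = fvar j) ->
    (forall j, (j <= m)%MM -> j != m -> tnth g i j = fvar i j) ->
  fcomp h g m = h m + h U_(i)%MM * (tnth g i m - fvar i m).
Proof.
move=> gi0 gvar gm.
(* One degree more than m needs, so that the variables survive truncation. *)
pose d := (mdeg m).+2.
have g0 : no_const g.
  move=> j; have [->//|/gvar->] := eqVneq j i.
  by rewrite /fvar eq_sym mnm1_eq0.
pose u := ftrunc d (tnth g i) - 'X_i.
have uE j : (mdeg j < d)%N -> u@_j = tnth g i j - fvar i j.
  by move=> jd; rewrite mcoeffB ftruncE // mcoeffX /fvar eq_sym.
have gE : [tuple ftrunc d (tnth g j) | j < k] =
          [tuple 'X_j + (j == i)%:R * u | j < k].
  apply: eq_from_tnth => j; rewrite !tnth_mktuple.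
  have [->|/gvar->] := eqVneq j i; first by rewrite mul1r addrC subrK.
  by rewrite mul0r addr0 ftrunc_fvar.
have dm : (mdeg m < d)%N by rewrite /d.
have di : (mdeg (U_(i) : 'X_{1..k}) < d)%N by rewrite mdeg1.
rewrite (fcompE (d := d)) // gE.
under eq_bigr => e _.
  rewrite mcoeff_perturb_monomial; first last.
  - move=> j jm jnm; rewrite uE ?gm ?subrr //.
    by apply: leq_ltn_trans dm; rewrite -(submK jm) mdegD leq_addl.
  - by rewrite uE ?mdeg0 // gi0 /fvar eq_sym mnm1_eq0 subrr.
  rewrite mulrDr mulrA. over.
rewrite big_split /= -mulr_suml uE //; congr (_ + _ * _).
  rewrite (bigD1 (BMultinom dm)) //= eqxx mulr1 big1 ?addr0 // => e.
  by rewrite bmeqP => /negPf /= ->; rewrite mulr0.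
rewrite (bigD1 (BMultinom di)) //= eqxx mulr1 big1 ?addr0 // => e.
by rewrite bmeqP => /negPf /= ->; rewrite mulr0.
Qed.

End Substitution.

Section Rename.
Variables (C : numClosedFieldType) (n k : nat) (s : 'I_n -> 'I_k).

(** The exponent of the monomial obtained from X^e by writing X_(s i) for
    X_i. *)
Definition mrename (e : 'X_{1..n}) : 'X_{1..k} :=
  [multinom (\sum_(i | s i == j) e i)%N | j < k].

Lemma mrename0 : mrename 0%MM = 0%MM.
Proof. by apply/mnmP => j; rewrite mnmE mnm0E big1 // => i; rewrite mnm0E. Qed.

Lemma mrenameD e e' : mrename (e + e')%MM = (mrename e + mrename e')%MM.
Proof.
apply/mnmP => j; rewrite mnmDE !mnmE -big_split.
by apply: eq_bigr => i _; rewrite mnmDE.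
Qed.

Lemma mrename1 i : mrename U_(i)%MM = U_(s i)%MM.
Proof.
apply/mnmP => j; rewrite mnmE mnm1E big_mkcond (bigD1 i) //= mnm1E eqxx.
rewrite big1 ?addn0 => [|l /negPf li]; first by case: eqP.
by rewrite mnm1E [i == l]eq_sym li; case: ifP.
Qed.

Lemma mrenameE e i : injective s -> mrename e (s i) = e i.
Proof.
move=> s_inj; rewrite mnmE (eq_bigl (pred1 i)) ?big_pred1_eq // => l.
by rewrite /= (inj_eq s_inj).
Qed.

Variables (f : fps C n) (g : n.-tuple (fps C k)).
Hypothesis gE : forall i, tnth g i = fvar (s i).

Lemma rename_no_const : no_const g.
Proof. by move=> i; rewrite gE fvar0. Qed.

Lemma fcomp_rename_supp m :
  fcomp f g m != 0 -> exists2 e, f e != 0 & m = mrename e.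
Proof.
apply: (fcomp_supp (P := fun e m => m = mrename e) rename_no_const).
- by rewrite mrename0.
- by move=> i e m1 m2 -> ->; rewrite mrenameD.
- by move=> i m'; rewrite gE mrename1; apply: fvar_neq0.
Qed.

Lemma fcomp_rename e : injective s -> fcomp f g (mrename e) = f e.
Proof.
move=> s_inj; pose P e m := m = mrename e.
have P0 : P 0%MM 0%MM by rewrite /P mrename0.
have PD i e' m m' : P U_(i)%MM m -> P e' m' -> P (U_(i) + e')%MM (m + m')%MM.
  by rewrite /P => -> ->; rewrite mrenameD.
have PU i m : tnth g i m != 0 -> P U_(i)%MM m.
  by rewrite gE /P mrename1; apply: fvar_neq0.
have -> := fcomp_lead rename_no_const P0 PD PU mrename0
             (fun i => mrenameD U_(i)%MM).
- rewrite big1 ?mulr1 // => i _.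
  by rewrite mrename1 gE /fvar eqxx expr1n.
- by [].
- move=> e' E /eqP[]; apply/mnmP => i.
  by rewrite -!(mrenameE _ _ s_inj) -E.
Qed.

End Rename.

(** * The weight order *)

Notation iz := (@Ordinal 3 0 isT).
Notation ichi := (@Ordinal 3 1 isT).
Notation itau := (@Ordinal 3 2 isT).

Lemma ord3P (P : 'I_3 -> Prop) : P iz -> P ichi -> P itau -> forall i, P i.
Proof.
by move=> P0 P1 P2 [[|[|[|?]]] // ?]; [move: P0|move: P1|move: P2];
   congr P; apply: val_inj.
Qed.

Lemma mnm3P (m m' : 'X_{1..3}) :
  m iz = m' iz -> m ichi = m' ichi -> m itau = m' itau -> m = m'.
Proof. by move=> *; apply/mnmP; apply: ord3P. Qed.

(** The first two conditions are the order on pairs that defines invariant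
    pairs.  The chi-exponents are compared for equal pairs only: conj F(chi, tau)
    trades powers of chi for powers of tau, so that below a given pair all
    powers of chi have to be considered at once. *)
Definition weight_le (k m : 'X_{1..3}) :=
  [&& k iz + k itau <= m iz + m itau, k itau <= m itau
    & ((k iz == m iz) && (k itau == m itau)) ==> (k ichi <= m ichi)]%N.

Definition weight_lt k m := weight_le k m && (k != m).

Lemma weight_leD a m b m' :
  weight_le a m -> weight_le b m' -> weight_le (a + b)%MM (m + m')%MM.
Proof. by rewrite /weight_le !mnmDE; lia. Qed.

(** A product attains the lower bound of its monomials only through the
    lowest monomials of its factors. *)
Lemma weight_le_split a m b m' : weight_le a m -> weight_le b m' ->
  (m + m' = a + b)%MM -> m = a.
Proof.
rewrite /weight_le => am bm E.
have E0 : (m iz + m' iz = a iz + b iz)%N by rewrite -!mnmDE E.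
have E1 : (m ichi + m' ichi = a ichi + b ichi)%N by rewrite -!mnmDE E.
have E2 : (m itau + m' itau = a itau + b itau)%N by rewrite -!mnmDE E.
by apply: mnm3P; lia.
Qed.

Lemma weight_le_refl m : weight_le m m.
Proof. by rewrite /weight_le; lia. Qed.

Lemma lem_weight_le k m : (k <= m)%MM -> weight_le k m.
Proof.
move=> /mnm_lepP km; rewrite /weight_le.
by move: (km iz) (km ichi) (km itau); lia.
Qed.

Lemma weight_lt_trans k l m : weight_lt k l -> weight_lt l m -> weight_lt k m.
Proof.
move=> /andP[kl nkl] /andP[lm nlm]; apply/andP; split.
  by move: kl lm; rewrite /weight_le; lia.
apply: contraNneq nkl => km; apply/eqP; move: kl lm; rewrite km /weight_le.
by move=> ? ?; apply: mnm3P; lia.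
Qed.

(** A strictly smaller pair has a smaller value of a + 2 b, although
    infinitely many monomials may lie below a given one. *)
Lemma weight_lt_ind (P : 'X_{1..3} -> Prop) :
  (forall m, (forall k, weight_lt k m -> P k) -> P m) -> forall m, P m.
Proof.
move=> IH m; have [a] := ubnP (m iz + (m itau).*2).
elim: a m => // a IHa m; have [b] := ubnP (m ichi).
elim: b m => // b IHb m mb ma; apply: IH => k /andP[km kneq].
have [kma|kma] := ltnP (k iz + (k itau).*2) (m iz + (m itau).*2).
  by apply: IHa; lia.
have kz : k iz = m iz by move: km; rewrite /weight_le; lia.
have kt : k itau = m itau by move: km; rewrite /weight_le; lia.
have kc : k ichi <> m ichi by move=> kc; case/eqP: kneq; apply: mnm3P.
by apply: IHb; move: km; rewrite /weight_le; lia.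
Qed.

Section Leading.
Variable C : numClosedFieldType.
Implicit Types f g : fps C 3.

Definition leading f m := f m != 0 /\ forall k, weight_lt k m -> f k = 0.

(** Comparing f and g only where both vanish below suffices: by induction the
    two vanish below the same monomials. *)
Lemma leading_transfer f g :
    (forall m, (forall k, weight_lt k m -> f k = 0) ->
       (forall k, weight_lt k m -> g k = 0) -> (f m == 0) = (g m == 0)) ->
  forall m, leading f m <-> leading g m.
Proof.
move=> fg.
have D m : (forall k, weight_lt k m -> f k = 0) <->
           (forall k, weight_lt k m -> g k = 0).
  elim/weight_lt_ind: m => m IH; split=> below k km;
    have below' l (lk : weight_lt l k) := below l (weight_lt_trans lk km);
    apply/eqP.
  - by rewrite -fg ?below //; apply/(IH k km).
  - by rewrite fg ?below //; apply/(IH k km).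
move=> m; split=> -[nz below]; have below' := below; first rewrite D in below'.
  by split=> //; rewrite -fg.
by rewrite -D in below'; split=> //; rewrite fg.
Qed.

End Leading.

(** * Leading monomials and the invariant set *)

Section Hypersurfaces.
Variable C : numClosedFieldType.

(** The order being multiplicative, the lowest monomial of f evaluated at g
    comes from the lowest monomials of the entries of g alone. *)
Lemma fcomp_weight_lead (f : fps C 3) (g : 3.-tuple (fps C 3)) m :
    (forall i k, tnth g i k != 0 -> weight_le U_(i)%MM k) ->
    (forall k, weight_lt k m -> f k = 0) ->
  fcomp f g m = f m * \prod_i (tnth g i U_(i)%MM) ^+ m i.
Proof.
move=> gU fm.
have g0 : no_const g.
  move=> i; apply/eqP; apply: contraT => /gU.
  by move: i; apply: ord3P; rewrite /weight_le !mnm1E !mnm0E.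
apply: (@fcomp_lead C 3 3 g weight_le g0 (weight_le_refl _) _ gU id) => //.
- by move=> i e k k'; apply: weight_leD.
- by move=> i e k k'; apply: weight_le_split.
- by move=> e em /negPf enm; apply: fm; rewrite /weight_lt em enm.
Qed.

Lemma dn0E n (f : fps C 1) : dn0 n f = n`!%:R * f (U_(ord0) *+ n)%MM.
Proof.
elim: n f => [|n IH] f; first by rewrite /dn0 /fat0 mul1r mulm0n.
have -> : dn0 n.+1 f = dn0 n (fderiv ord0 f) by rewrite /dn0 iterSr.
rewrite IH /fderiv mulmnE mnm1E eqxx mul1n mulrA -natrM mulmSr factS.
by rewrite mulnC.
Qed.

Lemma mnm3E i j k :
  ((mnm3 i j k iz = i) * (mnm3 i j k ichi = j) * (mnm3 i j k itau = k))%type.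
Proof. by []. Qed.

Lemma zs_coefE (f : fps C 3) alpha mu n :
  zs_coef f alpha mu (U_(ord0) *+ n)%MM = f (mnm3 alpha n mu).
Proof. by rewrite /zs_coef mulmnE mnm1E eqxx mul1n. Qed.

Lemma dn0_zs_coef n (f : fps C 3) alpha mu :
  dn0 n (zs_coef f alpha mu) = n`!%:R * f (mnm3 alpha n mu).
Proof. by rewrite dn0E zs_coefE. Qed.

(** For fixed (alpha, mu), minimality in the chi-exponent is the condition on
    n, and minimality of the pair is that of an invariant pair. *)
Lemma in_Lambda_leading (f : fps C 3) alpha n mu :
  in_Lambda f alpha n mu <-> leading f (mnm3 alpha n mu).
Proof.
have dn0_eq0 k : (dn0 k (zs_coef f alpha mu) == 0) = (f (mnm3 alpha k mu) == 0).
  by rewrite dn0_zs_coef mulf_eq0 pnatr_eq0 -[_ == 0%N]leqn0 leqNgt fact_gt0.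
split=> [[[nz below] fn fk]|[fn below]].
  split=> [|k /andP[]]; first by rewrite -dn0_eq0.
  rewrite /weight_le !mnm3E => km kn.
  have -> : k = mnm3 (k iz) (k ichi) (k itau) by apply: mnm3P.
  have [/andP[/eqP kz /eqP kt]|kzt] := boolP ((k iz == alpha) && (k itau == mu)).
    apply/eqP; rewrite kz kt -dn0_eq0 fk //.
    have : k ichi <> n by move=> kc; case/eqP: kn; apply: mnm3P.
    by move: km; lia.
  have /below/= : pair_lt (k iz, k itau) (alpha, mu).
    by rewrite /pair_lt /pair_le xpair_eqE kzt /=; move: km; lia.
  by move/(_ (U_(ord0) *+ k ichi)%MM); rewrite zs_coefE.
split; last 1 first.
- move=> k kn; apply/eqP; rewrite dn0_eq0 below //.
  rewrite /weight_lt /weight_le !mnm3E; apply/andP; split; first by lia.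
  by apply: contraTneq kn => /(congr1 (fun m : 'X_{1..3} => m ichi)) /=;
     rewrite !mnm3E => ->; rewrite ltnn.
- split=> [/(_ (U_(ord0) *+ n)%MM)|[a b] /andP[ab abn] m] /=.
    by rewrite zs_coefE => fn0; rewrite fn0 eqxx in fn.
  rewrite /zs_coef /= below //; move: ab abn.
  rewrite /pair_le /weight_lt /weight_le xpair_eqE !mnm3E /= => ab abn.
  apply/andP; split; first by lia.
  apply: contraNneq abn => E.
  have := congr1 (fun m : 'X_{1..3} => m iz) E.
  have := congr1 (fun m : 'X_{1..3} => m itau) E.
  by rewrite /= !mnm3E => -> ->; rewrite !eqxx.
- by rewrite dn0_eq0.
Qed.

(** * Two equations of one hypersurface in normal coordinates *)

Lemma fvar_tuple3 :
  [tuple var3_0; var3_1; var3_2] = [tuple fvar i | i < 3] :> 3.-tuple (fps C 3).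
Proof. by apply: eq_from_tnth; apply: ord3P; rewrite tnth_mktuple. Qed.

Lemma fcomp_kill (i : 'I_3) (f : fps C 3) (g : 3.-tuple (fps C 3))
    (m : 'X_{1..3}) :
    (forall j, tnth g j = if j == i then fzero else fvar j) -> m i = 0%N ->
  fcomp f g m = f m.
Proof.
move=> gE mi; rewrite fcomp_diag => [|j k]; last first.
  by rewrite gE; case: ifP => _; [rewrite /fzero eqxx|apply: fvar_neq0].
rewrite big1 ?mulr1 // => j _; rewrite gE.
have [->|_] := eqVneq j i; first by rewrite mi expr0.
by rewrite /fvar eqxx expr1n.
Qed.

Lemma normal_phi_z0 phi (m : 'X_{1..3}) :
  normal_phi phi -> m iz = 0%N -> phi m = 0 :> C.
Proof.
move=> [_ _ H] mz.
rewrite -(fcomp_kill (g := [tuple fzero; var3_1; var3_2]) phi _ mz) ?H //.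
by apply: ord3P.
Qed.

Lemma normal_Q_z0 Q (m : 'X_{1..3}) :
  normal_Q Q -> m iz = 0%N -> Q m = var3_2 m :> C.
Proof.
move=> [_ H _] mz.
rewrite -(fcomp_kill (g := [tuple fzero; var3_1; var3_2]) Q _ mz) ?H //.
by apply: ord3P.
Qed.

Lemma normal_Q_chi0 Q (m : 'X_{1..3}) :
  normal_Q Q -> m ichi = 0%N -> Q m = var3_2 m :> C.
Proof.
move=> [H _ _] mchi.
rewrite -(fcomp_kill (g := [tuple var3_0; fzero; var3_2]) Q _ mchi) ?H //.
by apply: ord3P.
Qed.

Lemma normal_Q_at0 Q : normal_Q Q -> Q 0%MM = 0 :> C.
Proof. by move=> nQ; rewrite (normal_Q_z0 nQ) ?mnm0E // /var3_2 fvar0. Qed.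

(** The parametrization w = Q(z, chi, tau) of the complexified hypersurface,
    in the order z, w, conj z, conj w. *)
Definition on_Q (Q : fps C 3) : 4.-tuple (fps C 3) :=
  [tuple var3_0; Q; var3_1; var3_2].

Section OnQ.
Variable Q : fps C 3.
Hypothesis nQ : normal_Q Q.

Lemma on_Q_no_const : no_const (on_Q Q).
Proof.
by apply: no_constP; do !split; rewrite ?(normal_Q_at0 nQ) //; apply: fvar0.
Qed.
Let Q0 := on_Q_no_const.

Lemma eq_Q_on_Q : fcomp (eq_Q Q) (on_Q Q) = fzero.
Proof.
rewrite /eq_Q (fcomp_sub Q0) (fcomp_var Q0) (fcomp_comp Q0).
  have -> : map_tuple (fcomp^~ (on_Q Q)) [tuple varz; varzb; varwb] =
            [tuple var3_0; var3_1; var3_2].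
    by apply: val_inj => /=; rewrite !(fcomp_var Q0).
  rewrite fvar_tuple3 fcomp_id.
  by apply: boolp.funext => m; rewrite /fsub subrr.
by apply: no_constP; do !split; apply: fvar0.
Qed.

Lemma eq_phi_on_Q phi :
  fcomp (eq_phi phi) (on_Q Q) =
  fsub (fscale (2%:R * 'i)^-1 (fsub Q var3_2))
       (fcomp phi [tuple var3_0; var3_1; fscale 2%:R^-1 (fadd Q var3_2)]).
Proof.
rewrite /eq_phi (fcomp_sub Q0) (fcomp_scale Q0) (fcomp_sub Q0).
rewrite !(fcomp_var Q0) (fcomp_comp Q0).
  congr fsub; congr (fcomp _ _); apply: val_inj => /=.
  by rewrite (fcomp_scale Q0) (fcomp_add Q0) !(fcomp_var Q0).
apply: no_constP; do !split; try exact: fvar0.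
by rewrite /fscale /fadd /varw /varwb !fvar0 addr0 mulr0.
Qed.

(** Both defining series vanish on the parametrized hypersurface, the
    cofactors being units. *)
Lemma Q_phi_eq rho phi :
    given_by rho (eq_phi phi) -> given_by rho (eq_Q Q) ->
  fscale (2%:R * 'i)^-1 (fsub Q var3_2) =
  fcomp phi [tuple var3_0; var3_1; fscale 2%:R^-1 (fadd Q var3_2)].
Proof.
move=> [a [a0 /boolp.funext ra]] [b [b0 /boolp.funext rb]].
have E : fcomp (eq_phi phi) (on_Q Q) = fzero.
  apply: (@fmul_unit_eq0 _ _ (fcomp a (on_Q Q))); first by rewrite /fat0 fcomp_at0.
  rewrite -fcomp_mul // -ra rb fcomp_mul // eq_Q_on_Q.
  by apply: boolp.funext => m; rewrite /fmul big1 // => k _; rewrite mulr0.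
move: E; rewrite eq_phi_on_Q => E; apply: boolp.funext => m.
by apply/eqP; rewrite -subr_eq0; apply/eqP; apply: (congr1 (@^~ m) E).
Qed.

Lemma fsub_tau_supp (m : 'X_{1..3}) :
  fsub Q var3_2 m != 0 -> (0 < m iz)%N /\ (0 < m ichi)%N.
Proof.
rewrite /fsub => nz; rewrite !lt0n; split; apply: contraNneq nz => m0.
  by rewrite (normal_Q_z0 nQ m0) subrr.
by rewrite (normal_Q_chi0 nQ m0) subrr.
Qed.

(** In phi(z, chi, tau + q / 2) the correction of first order is
    phi_tau(0) q / 2, and phi_tau(0) = 0 since phi is divisible by z. *)
Lemma leading_phi_Q rho phi : normal_phi phi ->
    given_by rho (eq_phi phi) -> given_by rho (eq_Q Q) ->
  forall m, leading (fsub Q var3_2) m <-> leading phi m.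
Proof.
move=> nphi rphi rQ; apply: leading_transfer => m Qm _.
have := congr1 (@^~ m) (Q_phi_eq rphi rQ) => /=.
rewrite (@fcomp_perturb _ _ itau) /=.
- have -> : phi U_(itau)%MM = 0 by apply: normal_phi_z0; rewrite ?mnm1E.
  rewrite mul0r addr0 => <-; rewrite /fscale mulf_eq0 invr_eq0 mulf_eq0.
  by rewrite pnatr_eq0 (negPf (neq0Ci _)).
- by rewrite /tnth /= /fscale /fadd (normal_Q_at0 nQ) /var3_2 fvar0 addr0 mulr0.
- by apply: ord3P.
- move=> j jm jnm; rewrite /tnth /= /fscale /fadd.
  have /eqP : fsub Q var3_2 j = 0 by apply: Qm; rewrite /weight_lt lem_weight_le.
  rewrite subr_eq0 => /eqP ->.
  have half (x : C) : 2%:R^-1 * (x + x) = x by field.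
  exact: half.
Qed.

End OnQ.

End Hypersurfaces.

(** * The effect of a formal biholomorphism *)

Section Map.
Variable C : numClosedFieldType.
Variables (Q Q' : fps C 3) (F G : fps C 2).
Hypotheses (nQ : normal_Q Q) (nQ' : normal_Q Q').
Hypotheses (F0 : F 0%MM = 0) (G0 : G 0%MM = 0).

Definition hol_on_Q (f : fps C 2) : fps C 3 := fcomp f [tuple var3_0; Q].
Definition antihol (f : fps C 2) : fps C 3 :=
  fcomp (fconj f) [tuple var3_1; var3_2].

(** The arguments z', conj z', conj w' of Q' along the image of the
    parametrized hypersurface. *)
Definition map_on_Q : 3.-tuple (fps C 3) :=
  [tuple hol_on_Q F; antihol F; antihol G].

Let Q0 := on_Q_no_const nQ.

Lemma hol_no_const (q : fps C 3) :
  q 0%MM = 0 -> no_const [tuple var3_0; q].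
Proof. by move=> q0; apply: no_constP; do !split; rewrite ?q0 //; apply: fvar0. Qed.

Lemma antihol_no_const : no_const [tuple var3_1; var3_2 : fps C 3].
Proof. by apply: no_constP; do !split; apply: fvar0. Qed.

Lemma fconj0 (f : fps C 2) : f 0%MM = 0 -> fconj f 0%MM = 0.
Proof. by rewrite /fconj => ->; rewrite conjC0. Qed.

Lemma map_on_Q_no_const : no_const map_on_Q.
Proof.
have Q00 := normal_Q_at0 nQ.
by apply: no_constP; do !split; rewrite ?/hol_on_Q ?/antihol fcomp_at0 ?fconj0 //;
  (exact: hol_no_const || exact: antihol_no_const).
Qed.

Lemma pullback_on_Q (r : fps C 4) :
  fcomp (pullback [tuple F; G] r) (on_Q Q) =
  fcomp r [tuple hol_on_Q F; hol_on_Q G; antihol F; antihol G].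
Proof.
have z0 : no_const [tuple varz; varw : fps C 4].
  by apply: no_constP; do !split; apply: fvar0.
have zb0 : no_const [tuple varzb; varwb : fps C 4].
  by apply: no_constP; do !split; apply: fvar0.
rewrite /pullback (fcomp_comp Q0); last first.
  by apply: no_constP; do !split; rewrite fcomp_at0 ?fconj0.
have hol f : fcomp (fcomp f [tuple varz; varw]) (on_Q Q) = hol_on_Q f.
  rewrite (fcomp_comp Q0 f z0); congr (fcomp _ _); apply: val_inj.
  by rewrite /= !(fcomp_var Q0).
have ahol f :
    fcomp (fcomp (fconj f) [tuple varzb; varwb]) (on_Q Q) = antihol f.
  rewrite (fcomp_comp Q0 _ zb0); congr (fcomp _ _); apply: val_inj.
  by rewrite /= !(fcomp_var Q0).
congr (fcomp _ _); apply: val_inj.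
by congr [:: _; _; _; _]; [exact: hol|exact: hol|exact: ahol|exact: ahol].
Qed.

(** The image of the parametrized hypersurface satisfies the equation
    w' = Q'(z', conj z', conj w'). *)
Lemma map_equation rho rho' :
    given_by rho (eq_Q Q) -> given_by rho' (eq_Q Q') ->
    sends_into [tuple F; G] rho rho' ->
  hol_on_Q G = fcomp Q' map_on_Q.
Proof.
move=> [a [_ /boolp.funext ra]] [b [b0 /boolp.funext rb]] [c /boolp.funext Hc].
set t := [tuple hol_on_Q F; hol_on_Q G; antihol F; antihol G].
have t0 : no_const t.
  have Q00 := normal_Q_at0 nQ.
  by apply: no_constP; do !split; rewrite ?/hol_on_Q ?/antihol fcomp_at0 ?fconj0 //;
    (exact: hol_no_const || exact: antihol_no_const).
have fmul0 (f : fps C 3) : fmul f fzero = fzero.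
  by apply: boolp.funext => m; rewrite /fmul big1 // => k _; rewrite mulr0.
have E : fcomp (eq_Q Q') t = fzero.
  apply: (@fmul_unit_eq0 _ _ (fcomp b t)); first by rewrite /fat0 fcomp_at0.
  rewrite -fcomp_mul // -rb -pullback_on_Q Hc ra !(fcomp_mul Q0) eq_Q_on_Q //.
  by rewrite !fmul0.
move: E; rewrite /eq_Q (fcomp_sub t0) (fcomp_var t0) (fcomp_comp t0); last first.
  by apply: no_constP; do !split; apply: fvar0.
have -> : map_tuple (fcomp^~ t) [tuple varz; varzb; varwb] = map_on_Q.
  by apply: val_inj => /=; rewrite !(fcomp_var t0).
move=> E; apply: boolp.funext => m; apply/eqP; rewrite -subr_eq0; apply/eqP.
exact: (congr1 (@^~ m) E).
Qed.

(** Expanding f(z, Q) around Q = tau turns the variables (z, w) into (z, tau);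
    conjugation turns them into (chi, tau). *)
Definition ord_zw (i : 'I_2) : 'I_3 := if i == ord0 then iz else itau.
Definition ord_chitau (i : 'I_2) : 'I_3 := if i == ord0 then ichi else itau.

Lemma ord2P (P : 'I_2 -> Prop) : P ord0 -> P ord_max -> forall i, P i.
Proof.
by move=> P0 P1 [[|[|?]] // ?]; [move: P0|move: P1]; congr P; apply: val_inj.
Qed.

Lemma ord_zw_inj : injective ord_zw.
Proof. by move=> i j; elim/ord2P: i; elim/ord2P: j. Qed.

Lemma ord_chitau_inj : injective ord_chitau.
Proof. by move=> i j; elim/ord2P: i; elim/ord2P: j. Qed.

Lemma tuple_zw i : tnth [tuple var3_0; var3_2] i = fvar (ord_zw i) :> fps C 3.
Proof. by elim/ord2P: i. Qed.

Lemma tuple_chitau i :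
  tnth [tuple var3_1; var3_2] i = fvar (ord_chitau i) :> fps C 3.
Proof. by elim/ord2P: i. Qed.

Lemma zw_chi e : mrename ord_zw e ichi = 0%N.
Proof. by rewrite mnmE big1 //; apply: ord2P. Qed.

Lemma chitau_z e : mrename ord_chitau e iz = 0%N.
Proof. by rewrite mnmE big1 //; apply: ord2P. Qed.

Lemma zw_supp (f : fps C 2) m :
  fcomp f [tuple var3_0; var3_2] m != 0 ->
  exists2 e, f e != 0 & m = mrename ord_zw e.
Proof. exact: (fcomp_rename_supp tuple_zw). Qed.

Lemma zwE (f : fps C 2) e :
  fcomp f [tuple var3_0; var3_2] (mrename ord_zw e) = f e.
Proof. exact: (fcomp_rename f tuple_zw e ord_zw_inj). Qed.

Lemma antihol_supp (f : fps C 2) m : antihol f m != 0 ->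
  exists2 e, f e != 0 & m = mrename ord_chitau e.
Proof.
move=> /(fcomp_rename_supp tuple_chitau)[e fe ->]; exists e => //.
by move: fe; rewrite /fconj conjC_eq0.
Qed.

Lemma antiholE (f : fps C 2) e : antihol f (mrename ord_chitau e) = (f e)^*.
Proof. exact: (fcomp_rename (fconj f) tuple_chitau e ord_chitau_inj). Qed.

Let q := fsub Q var3_2.
Let q' := fsub Q' var3_2.

Lemma hol_on_QE (f : fps C 2) m : (forall j, (j <= m)%MM -> j != m -> q j = 0) ->
  hol_on_Q f m = fcomp f [tuple var3_0; var3_2] m + f U_(ord_max)%MM * q m.
Proof.
move=> qm; have g0 : no_const [tuple var3_0; var3_1; Q].
  by apply: no_constP; do !split; rewrite ?(normal_Q_at0 nQ) //; apply: fvar0.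
have -> : hol_on_Q f =
    fcomp (fcomp f [tuple var3_0; var3_2]) [tuple var3_0; var3_1; Q].
  rewrite (fcomp_comp g0); last by apply: hol_no_const; apply: fvar0.
  by congr (fcomp _ _); apply: val_inj => /=; rewrite !(fcomp_var g0).
rewrite (@fcomp_perturb _ _ itau).
- have -> : U_(itau)%MM = mrename ord_zw U_(ord_max)%MM by rewrite mrename1.
  by rewrite zwE.
- exact: (normal_Q_at0 nQ).
- by apply: ord3P.
- move=> j jm jnm; apply/eqP; rewrite -subr_eq0; apply/eqP; exact: qm.
Qed.

(** Where z or chi is absent, so is q, and Q may be replaced by tau. *)
Lemma hol_on_Q_low (f : fps C 2) (m : 'X_{1..3}) : m iz = 0%N \/ m ichi = 0%N ->
  hol_on_Q f m = fcomp f [tuple var3_0; var3_2] m.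
Proof.
move=> m0; have q0 j : (j <= m)%MM -> q j = 0.
  move=> /mnm_lepP jm; apply/eqP; apply: contraT => /(fsub_tau_supp nQ)[jz jc].
  by move: (jm iz) (jm ichi); lia.
rewrite hol_on_QE => [|j jm _]; last exact: q0.
by rewrite q0 ?mulr0 ?addr0 // lepm_refl.
Qed.

Hypothesis map_eq : hol_on_Q G = fcomp Q' map_on_Q.

Lemma map_eqE m : hol_on_Q G m = antihol G m + fcomp q' map_on_Q m.
Proof.
have -> : fcomp q' map_on_Q = fsub (hol_on_Q G) (antihol G).
  by rewrite (fcomp_sub map_on_Q_no_const) -map_eq (fcomp_var map_on_Q_no_const).
by rewrite /fsub addrC subrK.
Qed.

Lemma antihol_deg (f : fps C 2) m : f 0%MM = 0 -> antihol f m != 0 ->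
  m iz = 0%N /\ (0 < m ichi + m itau)%N.
Proof.
move=> f0 /antihol_supp[e fe ->]; rewrite chitau_z; split=> //.
rewrite -[ichi]/(ord_chitau ord0) -[itau]/(ord_chitau ord_max).
rewrite !(mrenameE _ _ ord_chitau_inj) lt0n; apply: contraNneq fe => e0.
suff -> : e = 0%MM by rewrite f0.
by apply/mnmP; apply: ord2P; rewrite mnm0E; lia.
Qed.

(** On chi = tau = 0 the equation of the map reads
    G(z, 0) = Q'(F(z, 0), 0, 0) = 0. *)
Lemma G_z_axis (e : 'X_{1..2}) : e ord_max = 0%N -> G e = 0.
Proof.
move=> e1; have [->//|e_neq0] := eqVneq e 0%MM.
have e0 : (0 < e ord0)%N.
  rewrite lt0n; apply: contraNneq e_neq0 => e0.
  by apply/eqP/mnmP; apply: ord2P; rewrite mnm0E.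
set m := mrename ord_zw e.
have mz : m iz = e ord0 by apply: (mrenameE e ord0 ord_zw_inj).
have mt : m itau = 0%N by apply: etrans (mrenameE e ord_max ord_zw_inj) e1.
have mc : m ichi = 0%N by apply: zw_chi.
have := map_eqE m; rewrite hol_on_Q_low; last by right.
rewrite zwE => ->.
have [->|/(antihol_deg G0)[]] := eqVneq (antihol G m) 0; last by lia.
rewrite add0r; apply/eqP; apply: contraT => nz.
(* Each factor conj F(chi, tau) of a term of q' supplies a chi or a tau. *)
have [|i k x y|i x|k] := fcomp_supp
  (P := fun k m => is_true (k ichi <= m ichi + m itau)%N) map_on_Q_no_const
  _ _ _ nz; rewrite ?mnm0E //.
- by rewrite !mnmDE; lia.
- by rewrite mnm1E; elim/ord3P: i => //= /(antihol_deg F0)[]; lia.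
- by case/(fsub_tau_supp nQ'); lia.
Qed.

Let Fz := F U_(ord0)%MM.
Let Gw := G U_(ord_max)%MM.

Lemma U_tau : U_(itau)%MM = mrename ord_zw U_(ord_max)%MM.
Proof. by rewrite mrename1. Qed.

(** The linear terms in tau of the equation of the map: q' has order at
    least two and does not contribute. *)
Lemma Gw_real : Gw^* = Gw.
Proof.
have := map_eqE U_(itau)%MM; rewrite hol_on_Q_low; last by left; rewrite mnm1E.
have -> : fcomp G [tuple var3_0; var3_2] U_(itau)%MM = Gw by rewrite U_tau zwE.
have -> : antihol G U_(itau)%MM = Gw^*.
  rewrite -antiholE; congr (antihol G _); by rewrite mrename1.
suff -> : fcomp q' map_on_Q U_(itau)%MM = 0 by rewrite addr0 => /esym.
apply/eqP; apply: contraT => nz.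
have [|i e x y|i x|e] := fcomp_supp
  (P := fun k m => is_true (mdeg k <= mdeg m)%N) map_on_Q_no_const _ _ _ nz.
- by rewrite !mdeg0.
- by move=> ie exy; rewrite !mdegD leq_add.
- rewrite mdeg1 lt0n mdeg_eq0; apply: contraNneq => ->.
  by rewrite map_on_Q_no_const.
- case/(fsub_tau_supp nQ') => ez ec; rewrite mdeg1 mdegE.
  by rewrite (bigD1 iz) //= (bigD1 ichi) //=; lia.
Qed.

Lemma antihol_G_tau m : antihol G m != 0 -> (0 < m itau)%N.
Proof.
move=> /antihol_supp[e Ge ->].
rewrite -[itau]/(ord_chitau ord_max) (mrenameE _ _ ord_chitau_inj) lt0n.
by apply: contraNneq Ge => e1; rewrite G_z_axis.
Qed.

Lemma hol_F_deg m : hol_on_Q F m != 0 -> (0 < m iz + m itau)%N.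
Proof.
apply: contraNT; rewrite -leqNgt leqn0 addn_eq0 => /andP[/eqP mz /eqP mt].
rewrite hol_on_Q_low; last by left.
apply: contraT => /zw_supp[e Fe mE].
have e0 : e = 0%MM.
  apply/mnmP; apply: ord2P; rewrite mnm0E -(mrenameE e _ ord_zw_inj) -mE //.
by rewrite e0 F0 eqxx in Fe.
Qed.

(** F(z, Q) lies in the ideal of z and tau, conj F(chi, tau) has no constant
    term, and conj G(chi, tau) is divisible by tau. *)
Lemma map_on_Q_weight i k : tnth map_on_Q i k != 0 -> weight_le U_(i)%MM k.
Proof.
elim/ord3P: i; rewrite /weight_le !mnm1E /= => nz.
- by have := hol_F_deg nz; lia.
- by have := antihol_deg F0 nz; lia.
- by have := antihol_G_tau nz; lia.
Qed.

Lemma map_on_Q_lead (m : 'X_{1..3}) :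
  \prod_i (tnth map_on_Q i U_(i)%MM) ^+ m i =
    Fz ^+ m iz * Fz^* ^+ m ichi * Gw^* ^+ m itau.
Proof.
rewrite (bigD1 iz) //= (bigD1 ichi) //= (bigD1 itau) //= big1 ?mulr1; last first.
  by apply: ord3P.
rewrite mulrA; congr (_ ^+ _ * _ ^+ _ * _ ^+ _).
- rewrite [LHS]hol_on_Q_low; last by right; rewrite mnm1E.
  by rewrite /Fz -zwE mrename1.
- by rewrite /Fz -antiholE mrename1.
- by rewrite /Gw -antiholE mrename1.
Qed.

(** A monomial without z or without chi occurs in neither q nor q'.  At any
    other m, neither G(z, tau) nor conj G(chi, tau) has a term, which leaves
    the linear term G_w(0) q_m and the leading term of the composition. *)
Lemma lead_transform m :
    (forall k, weight_lt k m -> q k = 0) -> (forall k, weight_lt k m -> q' k = 0) ->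
  q m * Gw = q' m * (Fz ^+ m iz * Fz^* ^+ m ichi * Gw^* ^+ m itau).
Proof.
move=> qm q'm; have [m0|] := boolP ((m iz == 0%N) || (m ichi == 0%N)).
  have vanish (r : fps C 3) : normal_Q r -> fsub r var3_2 m = 0.
    move=> nr; apply/eqP; apply: contraT => /(fsub_tau_supp nr)[].
    by case/orP: m0 => /eqP->.
  by rewrite /q /q' !vanish // !mul0r.
rewrite negb_or => /andP[mz mc].
have := map_eqE m; rewrite hol_on_QE; last first.
  by move=> j jm jnm; apply: qm; rewrite /weight_lt lem_weight_le.
have -> : fcomp G [tuple var3_0; var3_2] m = 0.
  apply/eqP; apply: contraT => /zw_supp[e _ mE].
  by rewrite mE zw_chi eqxx in mc.
have -> : antihol G m = 0.
  apply/eqP; apply: contraT => /antihol_supp[e _ mE].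
  by rewrite mE chitau_z eqxx in mz.
rewrite !add0r (fcomp_weight_lead map_on_Q_weight q'm) map_on_Q_lead => <-.
by rewrite mulrC.
Qed.

End Map.

Lemma fat0_fderiv (C : numClosedFieldType) n (i : 'I_n) (f : fps C n) :
  fat0 (fderiv i f) = f U_(i)%MM.
Proof. by rewrite /fat0 /fderiv add0m mnm0E mul1r. Qed.

(** As G_z(0) = 0, the Jacobian matrix is triangular. *)
Lemma jacobian_neq0 (C : numClosedFieldType) (F G : fps C 2) :
    jacobian0 [tuple F; G] \in unitmx -> G U_(ord0)%MM = 0 ->
  F U_(ord0)%MM != 0 /\ G U_(ord_max)%MM != 0.
Proof.
move=> J Gz.
have tF : tnth [tuple F; G] ord0 = F by [].
have tG : tnth [tuple F; G] ord_max = G by [].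
have trig : is_trig_mx (jacobian0 [tuple F; G])^T.
  apply/is_trig_mxP; apply: ord2P; apply: ord2P => // _.
  by rewrite !mxE /fat0 /fderiv tG add0m Gz mulr0.
move: J; rewrite unitmxE unitfE -det_tr (det_trig trig).
rewrite big_ord_recl big_ord_recl big_ord0 mulr1 !mxE mulf_eq0 negb_or.
have -> : lift ord0 ord0 = ord_max :> 'I_2 by apply: val_inj.
by rewrite /fat0 /fderiv tF tG !add0m !mnm0E !mul1r => /andP.
Qed.

Theorem theorem6 (R : realType)
    (rho rho' : fps R[i] 4) (P P' : 2.-tuple (fps R[i] 2))
    (phi Q phi' Q' : fps R[i] 3) (F G : fps R[i] 2) :
  formal_hypersurface rho -> formal_hypersurface rho' ->
  normal_coordinates rho P phi Q -> normal_coordinates rho' P' phi' Q' ->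
  formal_biholomorphism [tuple F; G] ->
  sends_into [tuple F; G] (pullback P rho) (pullback P' rho') ->
  let Fz := fat0 (fderiv ord0 F) in
  let Gw := fat0 (fderiv ord_max G) in
  (forall alpha n mu : nat,
     in_Lambda phi alpha n mu <-> in_Lambda phi' alpha n mu) /\
  (forall alpha n mu : nat, in_Lambda phi alpha n mu ->
     dn0 n (zs_coef Q alpha mu) * Gw^* =
       dn0 n (zs_coef Q' alpha mu) * Fz ^+ alpha * Fz^* ^+ n * Gw^* ^+ mu /\
     forall (a : 'I_alpha -> R[i]) (b : 'I_n -> R[i]) (c : 'I_mu -> R[i]),
       tensorL Q a b c * Gw^* =
       tensorL Q' (fun i => Fz * a i) (fun i => Fz^* * b i)
                  (fun i => Gw^* * c i)).
Proof.
move=> _ _ [_ nphi rphi nQ rQ] [_ nphi' rphi' nQ' rQ'] [H0 J] sends Fz Gw.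
have F0 : F 0%MM = 0 by apply: (H0 ord0).
have G0 : G 0%MM = 0 by apply: (H0 ord_max).
have ME := map_equation nQ F0 G0 rQ rQ' sends.
have Gz : G U_(ord0)%MM = 0.
  by apply: (G_z_axis nQ nQ' F0 G0 ME); rewrite mnm1E.
have [] := jacobian_neq0 J Gz.
rewrite -!fat0_fderiv -/Fz -/Gw => Fz0 Gw0.
have GwR : Gw^* = Gw by rewrite /Gw fat0_fderiv (Gw_real nQ nQ' F0 G0 ME).
have Q_Q' m :
    (forall k, weight_lt k m -> fsub Q var3_2 k = 0) ->
    (forall k, weight_lt k m -> fsub Q' var3_2 k = 0) ->
  fsub Q var3_2 m * Gw = fsub Q' var3_2 m *
     (Fz ^+ m iz * Fz^* ^+ m ichi * Gw^* ^+ m itau).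
  rewrite /Fz /Gw !fat0_fderiv.
  exact: (lead_transform nQ nQ' F0 G0 ME).
have lead_Q_Q' : forall m,
    leading (fsub Q var3_2) m <-> leading (fsub Q' var3_2) m.
  apply: leading_transfer => m Qm Q'm.
  rewrite -(inj_eq (mulIf Gw0)) mul0r (Q_Q' m Qm Q'm) GwR.
  rewrite mulf_eq0 orbC mulf_eq0 mulf_eq0 !expf_eq0 conjC_eq0.
  by rewrite (negPf Fz0) (negPf Gw0) !andbF.
have lead_Q m := leading_phi_Q nQ nphi rphi rQ m.
have lead_Q' m := leading_phi_Q nQ' nphi' rphi' rQ' m.
split=> [alpha n mu|alpha n mu /in_Lambda_leading lead].
  split=> /in_Lambda_leading lead; apply/in_Lambda_leading.
    by apply/lead_Q'/lead_Q_Q'/lead_Q.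
  by apply/lead_Q/lead_Q_Q'/lead_Q'.
have [Qnz Qbelow] := (lead_Q _).2 lead.
have [_ Q'below] := (lead_Q_Q' _).1 (conj Qnz Qbelow).
(* phi vanishes at tau, so the monomial is not tau and Q agrees with q there. *)
have tau_out (r : fps R[i] 3) :
    fsub r var3_2 (mnm3 alpha n mu) = r (mnm3 alpha n mu).
  rewrite /fsub; suff -> : var3_2 (mnm3 alpha n mu) = 0 :> R[i] by rewrite subr0.
  apply/eqP; apply: contraT => /fvar_neq0 E; case: lead => /negP[].
  by rewrite (normal_phi_z0 nphi) // E mnm1E.
have dn : dn0 n (zs_coef Q alpha mu) * Gw^* =
       dn0 n (zs_coef Q' alpha mu) * Fz ^+ alpha * Fz^* ^+ n * Gw^* ^+ mu.
  have := Q_Q' _ Qbelow Q'below; rewrite !tau_out !dn0_zs_coef !mnm3E GwR => E.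
  by rewrite -mulrA E !mulrA.
split=> // a b c.
have prodZ k x (f : 'I_k -> R[i]) : \prod_i (x * f i) = x ^+ k * \prod_i f i.
  by rewrite big_split prodr_const card_ord.
rewrite /tensorL !prodZ.
transitivity ((n`!)%:R^-1 * (dn0 n (zs_coef Q alpha mu) * Gw^*) *
  (\prod_i a i) * (\prod_i b i) * (\prod_i c i)); first by ring.
by rewrite dn; ring.
Qed.
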